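(* Let $F$ be an $M\times N$ unit norm frame with $M<\frac{N-1}{4\log(4N)}$. Then there exists a frame $G$ that is flipping equivalent to $F$ and satisfies $\nu_G\leq\frac{\mu_G}{\sqrt{M}}$.
   Context: $\log$ is the natural logarithm. An $M\times N$ unit norm frame is a complex $M\times N$ matrix of rank $M$ whose columns $f_1,\ldots,f_N$ have Euclidean norm $1$. Frames $F$ and $G$ are flipping equivalent if $G=FD$ for some diagonal matrix $D$ with all diagonal entries in $\{+1,-1\}$. The worst-case coherence is $\mu_F:=\max_{i\neq j}|\langle f_i,f_j\rangle|$ and the average coherence is $\nu_F:=\frac{1}{N-1}\max_{i\in\{1,\ldots,N\}}\big|\sum_{j\neq i}\langle f_i,f_j\rangle\big|$, where $i,j$ range over $\{1,\ldots,N\}$. *)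

(* Defs.v *)
From mathcomp Require Export all_boot all_order all_algebra.
From mathcomp Require Export spectral complex.
From mathcomp Require Export reals exp.

Set Implicit Arguments.
Unset Strict Implicit.
Unset Printing Implicit Defensive.

Import Order.TTheory GRing.Theory Num.Theory.

Local Open Scope ring_scope.

(* The complex numbers are R[i]; Normc.normc : R[i] -> R is the modulus with
   values in R, as opposed to the norm `|_| : R[i] -> R[i]. *)

Definition col_norm (R : realType) (M N : nat) (F : 'M[R[i]]_(M, N))
    (j : 'I_N) : R :=
  Num.sqrt (\sum_(k < M) Normc.normc (F k j) ^+ 2).

(* dotmx is the Hermitian product of row vectors, linear in its first argument
   and conjugate-linear in its second, so columns are transposed. *)
Definition col_inner (R : realType) (M N : nat) (F : 'M[R[i]]_(M, N))
    (i j : 'I_N) : R[i] :=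
  dotmx (col i F)^T (col j F)^T.

Definition unit_norm_frame (R : realType) (M N : nat) (F : 'M[R[i]]_(M, N)) :
    Prop :=
  \rank F = M /\ forall j : 'I_N, col_norm F j = 1.

Definition flipping_equivalent (R : realType) (M N : nat)
    (F G : 'M[R[i]]_(M, N)) : Prop :=
  exists D : 'M[R[i]]_N,
    [/\ is_diag_mx D, forall j : 'I_N, D j j = 1 \/ D j j = -1 & G = F *m D].

(* In both maxima the terms are nonnegative, so the base value 0 only matters
   when the index set is empty. *)
Definition worst_case_coherence (R : realType) (M N : nat)
    (F : 'M[R[i]]_(M, N)) : R :=
  \big[Num.max/0]_(p : 'I_N * 'I_N | p.1 != p.2)
    Normc.normc (col_inner F p.1 p.2).

Definition average_coherence (R : realType) (M N : nat)
    (F : 'M[R[i]]_(M, N)) : R :=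
  (N%:R - 1)^-1 *
  \big[Num.max/0]_(i < N) Normc.normc (\sum_(j < N | j != i) col_inner F i j).

(* Main.v *)
(* Choosing the signs uniformly at random, Hoeffding's argument bounds the real
   and imaginary parts of all N row sums by (N - 1) mu / sqrt (2 M) at once: these
   are 2N sums of at most N - 1 signed terms bounded by mu, so each of the 4N
   one-sided tails has weight at most exp (- (N - 1) / (4 M)) < 1 / (4 N).  The
   average over all sign vectors is a finite sum, which factors into hyperbolic
   cosines, and cosh x <= exp (x^2 / 2). *)
Require Import Defs.
From mathcomp Require Import all_classical all_analysis.
From mathcomp Require Import ring lra.

Set Implicit Arguments.
Unset Strict Implicit.
Unset Printing Implicit Defensive.

Import Order.TTheory GRing.Theory Num.Theory.
Import numFieldNormedType.Exports.

Local Open Scope ring_scope.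

(** * The bound cosh x <= exp (x^2 / 2), by comparing power series *)

Lemma expn2_fact_leq_fact_double n : (2 ^ n * n`! <= (n.*2)`!)%N.
Proof.
elim: n => // n IHn; rewrite doubleS expnS !factS.
rewrite (_ : 2 * 2 ^ n * _ = n.+1.*2 * (2 ^ n * n`!))%N; last first.
  by rewrite -mul2n; ring.
by rewrite doubleS leq_mul// (leq_trans IHn)// leq_pmull.
Qed.

Lemma exp_coeff_addN (R : realType) (x : R) n :
  exp_coeff x n + exp_coeff (- x) n = if odd n then 0 else 2 * exp_coeff x n.
Proof.
rewrite /exp_coeff/= exprNn -signr_odd -mulrDl; case: odd.
  by rewrite expr1 mulN1r subrr mul0r.
by rewrite expr0; ring.
Qed.

Lemma exp_coeff_addN_ge0 (R : realType) (x : R) n :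
  0 <= exp_coeff x n + exp_coeff (- x) n.
Proof.
rewrite exp_coeff_addN; case: ifPn => // n_even.
by rewrite mulr_ge0// divr_ge0// exprn_even_ge0.
Qed.

Lemma exp_coeff_double_le (R : realType) (x : R) n :
  exp_coeff x n.*2 <= exp_coeff (x ^+ 2 / 2) n.
Proof.
rewrite /exp_coeff/= -mul2n exprM expr_div_n -mulrA.
rewrite ler_wpM2l ?(exprn_ge0 _ (sqr_ge0 x))// -invfM.
rewrite lef_pV2 ?posrE ?mulr_gt0 ?exprn_gt0 ?ltr0n ?fact_gt0//.
by rewrite -natrX -natrM ler_nat mul2n expn2_fact_leq_fact_double.
Qed.

Lemma sum_exp_coeff_cosh_le (R : realType) (x : R) n :
  \sum_(0 <= k < n.*2) (exp_coeff x k + exp_coeff (- x) k) <=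
  2 * \sum_(0 <= k < n) exp_coeff (x ^+ 2 / 2) k.
Proof.
elim: n => [|n IHn]; first by rewrite !big_geq ?mulr0.
rewrite doubleS !big_nat_recr//= mulrDr -addrA lerD//.
rewrite !exp_coeff_addN oddS odd_double addr0.
by rewrite ler_pM2l ?exp_coeff_double_le.
Qed.

(** On the left the odd terms cancel, and each even term satisfies x^(2n) / (2n)! <= (x^2 / 2)^n /
    n! because 2^n n! <= (2n)!. *)
Lemma cosh_le_expR_sqr (R : realType) (x : R) :
  expR x + expR (- x) <= 2 * expR (x ^+ 2 / 2).
Proof.
have cvx := @is_cvg_series_exp_coeff R.
rewrite /expR -limD//; apply: limr_le; first exact: is_cvgD.
apply: nearW => n.
(* The left partial sum is extended to [n.*2] terms, which match [n] terms on the right; the added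
   pairs are nonnegative. *)
have /le_trans : series (exp_coeff x) n + series (exp_coeff (- x)) n <=
    \sum_(0 <= k < n.*2) (exp_coeff x k + exp_coeff (- x) k).
  rewrite /series/= -big_split/= [leRHS](@big_cat_nat _ _ _ n)//=; last first.
    by rewrite -addnn leq_addr.
  by rewrite lerDl sumr_ge0// => k _; exact: exp_coeff_addN_ge0.
apply; apply: le_trans (sum_exp_coeff_cosh_le x n) _.
rewrite ler_pM2l//; apply: nondecreasing_cvgn_le => //.
apply: nondecreasing_series => k _ _; apply: exp_coeff_ge0.
by rewrite divr_ge0 ?sqr_ge0.
Qed.

(** * Sums with random signs *)

Definition signed_sum (R : realType) (I : finType) (e : {ffun I -> bool})
  (a : I -> R) : R := \sum_i (-1) ^+ e i * a i.

(** By distributivity the sum over all [e] is the product over [i] of exp (a i) + exp (- a i), and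
    each factor is at most 2 exp (a i ^ 2 / 2). *)
Lemma sum_expR_signed_sum_le (R : realType) (I : finType) (a : I -> R) :
  \sum_(e : {ffun I -> bool}) expR (signed_sum e a) <=
  #|{ffun I -> bool}|%:R * expR ((\sum_i a i ^+ 2) / 2).
Proof.
rewrite /signed_sum; under eq_bigr do rewrite expR_sum.
rewrite -(bigA_distr_bigA (fun i (b : bool) => expR ((-1) ^+ b * a i))) /=.
rewrite card_ffun card_bool natrX -prodr_const big_distrl/= expR_sum -big_split/=.
apply: ler_prod => i _; rewrite big_bool/= !(expr0, expr1) mul1r mulN1r.
by rewrite addr_ge0 ?expR_ge0//= addrC cosh_le_expR_sqr.
Qed.

(* The exponential moments of all [+- l * signed_sum e (a k)], summed over [k]
   and the sign, average over [e] to at most [2 #|K| exp (l^2 S / 2)]; the choice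
   [l = t / S] makes this less than [exp (l t)]. *)
Lemma exists_balancing_signs (R : realType) (K I : finType) (a : K -> I -> R)
    (S t : R) : 0 < S -> 0 <= t ->
    (forall k, \sum_i a k i ^+ 2 <= S) ->
    (2 * #|K|)%:R < expR (t ^+ 2 / (2 * S)) ->
  exists e : {ffun I -> bool}, forall k, `|signed_sum e (a k)| <= t.
Proof.
move=> S0 t0 aS Kt; pose l := t / S.
pose x (kb : K * bool) i := l * ((-1) ^+ kb.2 * a kb.1 i).
pose Phi e := \sum_kb expR (signed_sum e (x kb)).
have [e Phie] : exists e, Phi e < expR (t ^+ 2 / S).
  apply/not_existsP => PhiP.
  have : \sum_(e : {ffun I -> bool}) expR (t ^+ 2 / S) <= \sum_e Phi e.
    by apply: ler_sum => e _; rewrite leNgt; apply/negP.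
  apply/negP; rewrite -ltNge /Phi exchange_big/= sumr_const -[ltRHS]mulr_natl.
  have C0 : 0 < #|{ffun I -> bool}|%:R :> R.
    by rewrite ltr0n card_ffun card_bool expn_gt0.
  have xS kb : \sum_(e : {ffun I -> bool}) expR (signed_sum e (x kb)) <=
      #|{ffun I -> bool}|%:R * expR (t ^+ 2 / (2 * S)).
    apply: le_trans (sum_expR_signed_sum_le _) _.
    rewrite ler_pM2l// ler_expR.
    have -> : \sum_i x kb i ^+ 2 = l ^+ 2 * \sum_i a kb.1 i ^+ 2.
      rewrite big_distrr/=; apply: eq_bigr => i _.
      by rewrite /x !exprMn sqrr_sign mul1r.
    rewrite (_ : _ / (2 * S) = l ^+ 2 * S / 2); last by rewrite /l; field; lra.
    by rewrite ler_pM2r ?invr_gt0// ler_wpM2l ?sqr_ge0.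
  apply: le_lt_trans (ler_sum _ (fun kb _ => xS kb)) _.
  rewrite sumr_const card_prod card_bool mulnC -[ltLHS]mulr_natl mulrCA ltr_pM2l//.
  (* The threshold is a square: one factor is the moment bound, the other exceeds 2 #|K| by [Kt]. *)
  rewrite (_ : _ / S = t ^+ 2 / (2 * S) + t ^+ 2 / (2 * S)); last by field; lra.
  by rewrite expRD ltr_pM2r ?expR_gt0.
exists e => k; rewrite leNgt; apply/negP => tx.
(* For [t = 0] the hypothesis [Kt] would read 2 #|K| < 1, although [k] inhabits [K]. *)
have t_gt0 : 0 < t.
  rewrite lt0r t0 andbT; apply/eqP => t00; move: Kt.
  rewrite t00 expr0n/= mul0r expR0 -[1]/(1%:R) ltr_nat ltnS leqn0 muln_eq0/=.
  by apply/negP; rewrite -lt0n; apply/card_gt0P; exists k.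
have : expR (t ^+ 2 / S) < Phi e.
  (* The boolean picks the sign that turns this one term into exp (l |signed_sum e (a k)|), which
     already exceeds exp (l t). *)
  rewrite /Phi (bigD1 (k, signed_sum e (a k) < 0))//= ltr_wpDr//.
    by apply: sumr_ge0 => *; exact: expR_ge0.
  rewrite ltr_expR (_ : signed_sum e _ = l * `|signed_sum e (a k)|).
    by rewrite expr2 mulrAC -/l ltr_pM2l// divr_gt0.
  have [s0|s0] := ltP; rewrite /signed_sum.
    rewrite ltr0_norm// mulrN big_distrr/= -sumrN; apply: eq_bigr => i _.
    by rewrite /x/= expr1; ring.
  rewrite ger0_norm// big_distrr/=; apply: eq_bigr => i _.
  by rewrite /x/= expr0; ring.
by move=> /(lt_trans Phie); rewrite ltxx.
Qed.

(** * Sign flips of the columns and their effect on inner products *)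

Lemma col_innerE (R : realType) (M N : nat) (F : 'M[R[i]]_(M, N)) i j :
  col_inner F i j = \sum_k F k i * (F k j)^*.
Proof.
rewrite /col_inner dotmxE mxE; apply: eq_bigr => k _.
by rewrite !mxE.
Qed.

Definition flip (R : realType) (M N : nat) (F : 'M[R[i]]_(M, N))
  (e : {ffun 'I_N -> bool}) := F *m diag_mx (\row_j (-1) ^+ e j).

Lemma flipE (R : realType) (M N : nat) (F : 'M[R[i]]_(M, N)) e k j :
  flip F e k j = F k j * (-1) ^+ e j.
Proof. by rewrite /flip mul_mx_diag !mxE. Qed.

(** Signs are real, so conjugation fixes them. The sign of [i] is kept outermost: it factors out of
    the [i]-th row sum and does not affect its modulus. *)
Lemma col_inner_flip (R : realType) (M N : nat) (F : 'M[R[i]]_(M, N)) e i j :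
  col_inner (flip F e) i j = (-1) ^+ e i * ((-1) ^+ e j * col_inner F i j).
Proof.
rewrite !col_innerE !big_distrr/=; apply: eq_bigr => k _.
by rewrite !flipE rmorphM rmorph_sign; ring.
Qed.

Lemma normc_sign (R : realType) (b : bool) :
  Normc.normc ((-1) ^+ b : R[i]) = 1.
Proof.
by case: b; rewrite /Normc.normc/= ?oppr0 ?sqrrN expr1n expr0n addr0 sqrtr1.
Qed.

Lemma flip_equivalent (R : realType) (M N : nat) (F : 'M[R[i]]_(M, N)) e :
  flipping_equivalent F (flip F e).
Proof.
exists (diag_mx (\row_j (-1) ^+ e j)); split => //.
by move=> j; rewrite !mxE eqxx mulr1n; case: (e j); [right|left].
Qed.

Lemma unit_norm_frame_flip (R : realType) (M N : nat) (F : 'M[R[i]]_(M, N)) e :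
  unit_norm_frame F -> unit_norm_frame (flip F e).
Proof.
move=> [rF nF]; split.
  rewrite mxrankMfree// row_free_unit unitmxE det_diag unitfE prodf_seq_neq0.
  by apply/allP => j _; rewrite mxE signr_eq0.
move=> j; rewrite -(nF j) /col_norm; congr Num.sqrt; apply: eq_bigr => k _.
by rewrite flipE Normc.normcM normc_sign mulr1.
Qed.

Lemma worst_case_coherence_flip (R : realType) (M N : nat)
    (F : 'M[R[i]]_(M, N)) e :
  worst_case_coherence (flip F e) = worst_case_coherence F.
Proof.
apply: eq_bigr => p _.
by rewrite col_inner_flip !Normc.normcM !normc_sign !mul1r.
Qed.

Lemma worst_case_coherence_ge0 (R : realType) (M N : nat)
    (F : 'M[R[i]]_(M, N)) : 0 <= worst_case_coherence F.
Proof. exact: bigmax_ge_id. Qed.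

Lemma normc_col_inner_le (R : realType) (M N : nat) (F : 'M[R[i]]_(M, N)) i j :
  j != i -> Normc.normc (col_inner F i j) <= worst_case_coherence F.
Proof.
move=> ji; apply: (le_bigmax_cond _ (j := (i, j))
  (fun p => Normc.normc (col_inner F p.1 p.2))).
by rewrite eq_sym.
Qed.

(** * Real and imaginary parts of row sums, indexed by a boolean *)

Definition part (R : realType) (b : bool) (z : R[i]) : R :=
  if b then complex.Im z else complex.Re z.

(** Excluded indices get coefficient 0, so that the sum runs over all of [I] as in [signed_sum]. *)
Lemma part_signed_sum (R : realType) (I : finType) (P : pred I) (b : bool)
    (e : {ffun I -> bool}) (z : I -> R[i]) :
  part b (\sum_(i | P i) (-1) ^+ e i * z i) =
  signed_sum e (fun i => if P i then part b (z i) else 0).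
Proof.
rewrite (big_morph (part b) (id1 := 0) (op1 := +%R)); last first.
- by case: b.
- by case: b => -[? ?] [? ?].
rewrite /signed_sum big_mkcond/=; apply: eq_bigr => i _.
case: ifP => _; last by rewrite mulr0.
by case: (z i) => u v; case: b; case: (e i);
  rewrite ?expr0 ?expr1 ?mul1r ?mulN1r.
Qed.

Lemma normc_part (R : realType) (z : R[i]) :
  Normc.normc z = Num.sqrt (part false z ^+ 2 + part true z ^+ 2).
Proof. by case: z. Qed.

Lemma normc_ge0 (R : realType) (z : R[i]) : 0 <= Normc.normc z.
Proof. by rewrite normc_part sqrtr_ge0. Qed.

Lemma part_sqr_le (R : realType) (b : bool) (z : R[i]) :
  part b z ^+ 2 <= Normc.normc z ^+ 2.
Proof.
rewrite normc_part sqr_sqrtr ?addr_ge0 ?sqr_ge0//.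
by case: b; rewrite ?lerDl ?lerDr sqr_ge0.
Qed.

(** Signs are balanced for the family indexed by ['I_N * bool], whose 2N members make 2 #|K| equal
    to 4N, with [S] = (N - 1) mu^2. *)
Lemma exists_balanced_flip (R : realType) (M N : nat) (F : 'M[R[i]]_(M, N))
    (B : R) : 0 < worst_case_coherence F -> (1 < N)%N -> 0 <= B ->
    (4 * N)%:R < expR (B ^+ 2 / (4 * (N%:R - 1) * worst_case_coherence F ^+ 2)) ->
  exists e, forall i,
    Normc.normc (\sum_(j < N | j != i) col_inner (flip F e) i j) <= B.
Proof.
set mu := worst_case_coherence F => mu_gt0 N_gt1 B_ge0 NB.
have N1_gt0 : 0 < N%:R - 1 :> R by rewrite subr_gt0 ltr1n.
pose a (p : 'I_N * bool) (j : 'I_N) : R :=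
  if j != p.1 then part p.2 (col_inner F p.1 j) else 0.
have aS p : \sum_j a p j ^+ 2 <= (N%:R - 1) * mu ^+ 2.
  rewrite (bigD1 p.1)//= {1}/a eqxx expr0n add0r.
  have -> : (N%:R - 1) * mu ^+ 2 = \sum_(j < N | j != p.1) mu ^+ 2.
    rewrite sumr_const -[RHS]mulr_natl; congr (_ * _).
    have := cardC1 p.1; rewrite card_ord => ->.
    by rewrite -subn1 natrB// ltnW.
  apply: ler_sum => j jp; rewrite /a jp (le_trans (part_sqr_le _ _))//.
  by rewrite lerXn2r ?nnegrE ?normc_ge0 ?(ltW mu_gt0)// normc_col_inner_le.
have S_gt0 : 0 < (N%:R - 1) * mu ^+ 2 by rewrite mulr_gt0 ?exprn_gt0.
have B2 : (B / Num.sqrt 2) ^+ 2 = B ^+ 2 / 2.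
  by rewrite expr_div_n sqr_sqrtr.
(* If both parts are at most B / sqrt 2 in absolute value, the modulus is at most B. *)
have [||e eB] := exists_balancing_signs S_gt0 _ aS (t := B / Num.sqrt 2).
- by rewrite divr_ge0 ?sqrtr_ge0.
- rewrite card_prod card_ord card_bool mulnCA mulnC B2.
  rewrite (_ : _ / 2 / _ = B ^+ 2 / (4 * (N%:R - 1) * mu ^+ 2))//.
  by field; rewrite !gt_eqF.
exists e => i; under eq_bigr do rewrite col_inner_flip.
rewrite -big_distrr/= Normc.normcM normc_sign mul1r normc_part.
rewrite -[leRHS](ger0_norm B_ge0) -sqrtr_sqr.
rewrite ler_sqrt ?sqr_ge0// [leRHS](_ : _ = B ^+ 2 / 2 + B ^+ 2 / 2); last by field.
rewrite !part_signed_sum -B2 lerD// -real_normK ?num_real// lerXn2r ?nnegrE//.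
- by rewrite divr_ge0 ?sqrtr_ge0.
- exact: (eB (i, false)).
- by rewrite divr_ge0 ?sqrtr_ge0.
- exact: (eB (i, true)).
Qed.

Theorem theorem11 (R : realType) (M N : nat) (F : 'M[R[i]]_(M, N))
    (F_frame : unit_norm_frame F)
    (MN : M%:R < (N%:R - 1) / (4 * ln (4 * N%:R)) :> R) :
  exists G : 'M[R[i]]_(M, N),
    [/\ unit_norm_frame G,
        flipping_equivalent F G &
        average_coherence G <= worst_case_coherence G / Num.sqrt M%:R].
Proof.
(* For [N = 0], the conventions [ln 0 = 0] and [0^-1 = 0] make the bound in [MN] vanish; for [N = 1]
   its numerator does. *)
have N_gt1 : (1 < N)%N.
  case: N F F_frame MN => [|[|//]] F _ MN.
    by move: MN; rewrite mulr0 ln0// mulr0 invr0 mulr0 ltrn0.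
  by move: MN; rewrite subrr mul0r ltrn0.
(* A column with no entries has norm 0, not 1. *)
have M_gt0 : (0 < M)%N.
  case: M F F_frame {MN} => // F [_ /(_ (Ordinal N_gt1))].
  by rewrite /col_norm big_ord0 sqrtr0 => /esym/eqP; rewrite oner_eq0.
have N1_gt0 : 0 < N%:R - 1 :> R by rewrite subr_gt0 ltr1n.
have M_gt0' : 0 < M%:R :> R by rewrite ltr0n.
set mu := worst_case_coherence F.
pose B := (N%:R - 1) * (mu / Num.sqrt M%:R).
have mu_ge0 : 0 <= mu := worst_case_coherence_ge0 F.
have B_ge0 : 0 <= B by rewrite mulr_ge0 ?divr_ge0 ?sqrtr_ge0 ?(ltW N1_gt0).
suff [e eB] : exists e, forall i,
    Normc.normc (\sum_(j < N | j != i) col_inner (flip F e) i j) <= B.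
  exists (flip F e); split; [exact: unit_norm_frame_flip|exact: flip_equivalent|].
  rewrite worst_case_coherence_flip /average_coherence ler_pdivrMl//.
  by apply: bigmax_le.
(* When mu = 0 distinct columns are orthogonal and any signs work. *)
have [mu_gt0|mu_le0] := ltP 0 mu; last first.
  exists [ffun=> false] => i; rewrite big1 ?Normc.normc0// => j ji.
  apply: Normc.eq0_normc; apply/eqP; rewrite eq_le normc_ge0 andbT.
  apply: le_trans mu_le0; rewrite /mu -(worst_case_coherence_flip F [ffun=> false]).
  exact: normc_col_inner_le.
apply: exists_balanced_flip => //.
have N4_gt1 : 1 < (4 * N)%:R :> R by rewrite ltr1n (leq_trans N_gt1)// leq_pmull.
rewrite -[ltLHS]lnK ?posrE ?(lt_trans _ N4_gt1)// ltr_expR natrM.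
move: MN; rewrite ltr_pdivlMr ?mulr_gt0 -?natrM ?ln_gt0// => MN.
(* In the exponent mu and one factor N - 1 cancel, leaving exactly the hypothesis 4 M ln (4N) < N -
   1. *)
rewrite [ltRHS](_ : _ = (N%:R - 1) / (4 * M%:R)); last first.
  rewrite /B exprMn expr_div_n sqr_sqrtr ?ler0n// -/mu; field.
  by rewrite !gt_eqF.
by rewrite ltr_pdivlMr ?mulr_gt0// mulrC [_ * M%:R]mulrC -mulrA.
Qed.
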